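(* Let $n\ge 4$ and let $S=\{x,y,z,w\}$ be a set of four distinct vertices of $D_n$ lying in four pairwise distinct clusters of $D_n$. Then there exist $n-1$ internally disjoint $S$-trees in $D_n$.
   Context: The $n$-dimensional dual cube $D_n$ has vertex set all $(2n-1)$-bit binary strings $u_1u_2\cdots u_{2n-1}$. Two vertices $u,v$ are adjacent iff they differ in exactly one bit position $i$, and moreover: if $1\le i\le n-1$ then $u_{2n-1}=v_{2n-1}=0$; if $n\le i\le 2n-2$ then $u_{2n-1}=v_{2n-1}=1$; (if $i=2n-1$ there is no further condition). A cluster of class $0$ is a set of all vertices with last bit $0$ and a fixed value of the bits in positions $n,\dots,2n-2$; a cluster of class $1$ is a set of all vertices with last bit $1$ and a fixed value of the bits in positions $1,\dots,n-1$. The clusters partition $V(D_n)$. For $S\subseteq V(G)$, an $S$-tree is a subtree of $G$ whose vertex set contains $S$; a family of $S$-trees $T_1,\dots,T_m$ is internally disjoint if the trees are pairwise edge-disjoint and $V(T_i)\cap V(T_j)=S$ for all $i\ne j$. *)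

(* Defs.v *)
From mathcomp Require Import all_boot.
Set Implicit Arguments. Unset Strict Implicit. Unset Printing Implicit Defensive.

(* Vertices of D_n: (2n-1)-bit strings u_1 ... u_{2n-1}.  The paper's
   1-based bit position i is the 0-based index i-1 of the tuple. *)
Definition vert (n : nat) := (2 * n - 1).-tuple bool.

Definition bit (n : nat) (u : vert n) (i : nat) : bool := nth false u i.

Definition lastbit (n : nat) (u : vert n) : bool := bit u (2 * n - 2).

(* Adjacency of the dual cube D_n: u, v differ in exactly one (0-based)
   position j; if j <= n-2 (paper: 1 <= i <= n-1) both last bits are 0;
   if n-1 <= j <= 2n-3 (paper: n <= i <= 2n-2) both last bits are 1;
   if j = 2n-2 (paper: i = 2n-1) no further condition. *)
Definition dc_adj (n : nat) (u v : vert n) : bool :=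
  [exists j : 'I_(2 * n - 1),
     [forall k : 'I_(2 * n - 1), (tnth u k != tnth v k) == (k == j)] &&
     (if (j < n - 1)%N then ~~ lastbit u && ~~ lastbit v
      else if (j < 2 * n - 2)%N then lastbit u && lastbit v
      else true)].

(* The cluster containing u, encoded by its class and the fixed bits:
   class 0: last bit 0, bits at paper positions n..2n-2 (0-based n-1..2n-3);
   class 1: last bit 1, bits at paper positions 1..n-1 (0-based 0..n-2). *)
Definition cluster (n : nat) (u : vert n) : bool * seq bool :=
  if lastbit u then (true, take (n - 1) u)
  else (false, drop (n - 1) (take (2 * n - 2) u)).

Definition subgraph_of (V : finType) (adj : rel V)
    (Vt : {set V}) (Et : {set {set V}}) : Prop :=
  forall e, e \in Et ->
    exists u v, [/\ e = [set u; v], u != v, adj u v, u \in Vt & v \in Vt].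

Definition edge_rel (V : finType) (Et : {set {set V}}) : rel V :=
  fun a b => [set a; b] \in Et.

Definition sub_connected (V : finType) (Vt : {set V}) (Et : {set {set V}}) :
  Prop := forall u v, u \in Vt -> v \in Vt -> connect (edge_rel Et) u v.

Definition sub_acyclic (V : finType) (Et : {set {set V}}) : Prop :=
  ~ exists s : seq V, [/\ (3 <= size s)%N, uniq s & cycle (edge_rel Et) s].

Definition is_subtree (V : finType) (adj : rel V)
    (Vt : {set V}) (Et : {set {set V}}) : Prop :=
  [/\ Vt != set0, subgraph_of adj Vt Et, sub_connected Vt Et & sub_acyclic Et].

Definition is_Stree (V : finType) (adj : rel V) (S : {set V})
    (T : {set V} * {set {set V}}) : Prop :=
  is_subtree adj T.1 T.2 /\ S \subset T.1.

Definition internally_disjoint_Strees (V : finType) (adj : rel V)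
    (S : {set V}) (m : nat) (T : 'I_m -> {set V} * {set {set V}}) : Prop :=
  (forall i, is_Stree adj S (T i)) /\
  (forall i j, i != j -> [disjoint (T i).2 & (T j).2] /\ (T i).1 :&: (T j).1 = S).

(* Main.v *)
Require Import Defs.
From mathcomp Require Import all_boot zify.

Set Implicit Arguments. Unset Strict Implicit. Unset Printing Implicit Defensive.

(** Put m = n - 1. Clusters of either class are m-cubes, and the cluster u of
    class c and the cluster v of class ~~ c are joined by exactly one edge.
    The i-th tree contains one whole cluster of each class, with indices
    d_0(i) and d_1(i), distinct for distinct i and different from the clusters
    of the terminals. A terminal of class c reaches the class ~~ c hub of every
    tree by a fan inside its own cluster, whose i-th branch ends at the vertex
    d_(~~c)(i); all these pieces are disjoint for distinct i. If d_(~~c)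
    enumerates the neighbours of a centre o, the fan is given by explicit walks
    in cyclic coordinate order. Such a centre exists when at most three clusters
    of class ~~ c are forbidden, and no fan is needed when there are four. *)

(** * From connected vertex sets to internally disjoint trees *)

Definition induced_rel (V : finType) (e : rel V) (U : {set V}) : rel V :=
  fun u v => [&& u \in U, v \in U & e u v].

Lemma edge_rel_sym (V : finType) (E : {set {set V}}) : symmetric (edge_rel E).
Proof. by move=> a b; rewrite /edge_rel setUC. Qed.

(** The detour runs along [p] from [y] to its last vertex [z], avoiding [x], and then takes the edge
    from [z] to [x], which is not the deleted one because [z] differs from [y]. *)
Lemma connect_setD1_cycle (V : finType) (E : {set {set V}}) (x y : V) (p : seq V) :
  uniq [:: x, y & p] -> p != [::] -> cycle (edge_rel E) [:: x, y & p] ->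
  connect (edge_rel (E :\ [set x; y])) x y.
Proof.
case/lastP: p => // p z uq _; rewrite (cycle_path x) /= last_rcons rcons_path.
case/and3P=> Ezx _ /andP[pathE Epz].
move: uq; rewrite /= inE negb_or !mem_rcons rcons_uniq !inE !negb_or -!andbA.
case/and5P=> xy xz xp yz /and3P[yp zp up].
rewrite (sym_connect_sym (@edge_rel_sym V _)).
apply: (connect_trans (y := z)); last first.
  apply: connect1; rewrite /edge_rel !inE in Ezx *; rewrite [_ \in E]Ezx andbT.
  apply/eqP=> /setP/(_ y); rewrite !inE eqxx orbT (negPf yz) eq_sym.
  by rewrite (negPf xy).
apply/connectP; exists (rcons p z); last by rewrite last_rcons.
have sub : {in predC1 x &, subrel (edge_rel E) (edge_rel (E :\ [set x; y]))}.
  move=> a b /=; rewrite !inE /edge_rel !inE => ax bx ->; rewrite andbT.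
  apply/eqP=> /setP/(_ x); rewrite !inE eqxx.
  by rewrite ![x == _]eq_sym (negPf ax) (negPf bx).
apply: (sub_in_path (P := predC1 x) sub); last by rewrite rcons_path pathE.
rewrite /= eq_sym xy all_rcons /= eq_sym xz /=.
by apply/allP=> a ap /=; apply: contraNneq xp => <-.
Qed.

(** An inclusion-minimal edge set connecting [U] is acyclic: an edge on a cycle could be deleted and
    replaced by the rest of the cycle. *)
Lemma spanning_tree (V : finType) (e : rel V) (U : {set V}) (h : V) :
  irreflexive e -> h \in U ->
  {in U, forall u, connect (induced_rel e U) u h} ->
  exists E : {set {set V}},
    is_subtree e U E.
Proof.
move=> eirr hU conn.
pose E0 := [set [set p.1; p.2] | p : V * V & induced_rel e U p.1 p.2].
pose spans (E : {set {set V}}) :=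
  [forall u in U, forall v in U, connect (edge_rel E) u v].
have csym E := sym_connect_sym (@edge_rel_sym V E).
have spE0 : spans E0.
  have toh u : u \in U -> connect (edge_rel E0) u h.
    move=> /conn; apply: connect_sub => a b ab; apply: connect1.
    by apply/imsetP; exists (a, b) => //; rewrite inE.
  apply/forall_inP => u uU; apply/forall_inP => v vU.
  by apply: connect_trans (toh u uU) _; rewrite csym toh.
have [E /minsetP[spE minE] EE0] := minset_exists spE0.
exists E; split.
- by apply/set0Pn; exists h.
- move=> f /(subsetP EE0)/imsetP[[u v] /=]; rewrite inE => /and3P[uU vU euv] ->.
  exists u, v; split=> //=.
  by apply: contraTneq euv => ->; rewrite eirr.
- by move=> u v uU vU; apply: (forall_inP (forall_inP spE u uU) v vU).
case=> s []; case: s => [|x [|y [|z p]]] // _ uq cyc.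
have cxy := connect_setD1_cycle uq isT cyc.
have Exy : [set x; y] \in E by case/andP: cyc.
suff : spans (E :\ [set x; y]).
  move/minE => /(_ (subsetDl _ _)) /setP /(_ [set x; y]).
  by rewrite !inE eqxx Exy.
apply/forall_inP => u uU; apply/forall_inP => v vU.
apply: connect_sub (forall_inP (forall_inP spE u uU) v vU) => a b ab.
have [eqab|neqab] := eqVneq [set a; b] [set x; y]; last first.
  by apply: connect1; rewrite /edge_rel !inE neqab.
have : a \in [set x; y] by rewrite -eqab !inE eqxx.
have : b \in [set x; y] by rewrite -eqab !inE eqxx orbT.
rewrite !inE => /orP[]/eqP-> /orP[]/eqP-> //; exact: (etrans (csym _ _ _)) || exact: connect0.
Qed.

Lemma homo_connect (V V' : finType) (e : rel V) (e' : rel V') (f : V -> V')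
    (u v : V) :
  {homo f : a b / e a b >-> e' a b} -> connect e u v -> connect e' (f u) (f v).
Proof.
move=> ef /connectP[p pe ->]; apply/connectP; exists (map f p).
  exact: homo_path pe.
by rewrite last_map.
Qed.

Lemma uniq_map_inj_in (T T' : eqType) (f : T -> T') (s : seq T) :
  uniq (map f s) -> {in s &, injective f}.
Proof.
elim: s => //= a s IH /andP[fa us] x y.
rewrite !inE => /predU1P[->|xs] /predU1P[->|ys] // fxy; last exact: IH fxy.
- by rewrite fxy map_f in fa.
- by rewrite -fxy map_f in fa.
Qed.

(* Edges inside S are discarded: two trees could share them although their
   vertex sets meet only in S. *)
Definition leaving (V : finType) (e : rel V) (S : {set V}) : rel V :=
  fun u v => e u v && ~~ ((u \in S) && (v \in S)).

(** Only vertex sets have to be constructed. An edge common to two spanning trees would have both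
    ends in [U i :&: U j], hence in [S], and [leaving] excludes such edges. *)
Lemma internally_disjoint_Strees_of_sets (V : finType) (e : rel V)
    (S : {set V}) (m : nat) (U : 'I_m -> {set V}) (h : 'I_m -> V) :
  irreflexive e ->
  (forall i, S \subset U i) -> (forall i, h i \in U i) ->
  (forall i, {in U i, forall u, connect (induced_rel (leaving e S) (U i)) u (h i)}) ->
  (forall i j, i != j -> U i :&: U j \subset S) ->
  exists T, @internally_disjoint_Strees V e S m T.
Proof.
move=> eirr SU hU conn UI.
have lirr : irreflexive (leaving e S) by move=> u; rewrite /leaving eirr.
have /fin_all_exists[E treeE] i := spanning_tree lirr (hU i) (conn i).
exists (fun i => (U i, E i)); split=> [i|i j ij].
  split=> //=; case: (treeE i) => U0 sub Uc Ea; split=> // f fE.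
  by have [u [v [-> uv /andP[euv _] uU vU]]] := sub f fE; exists u, v.
split; last by apply/eqP; rewrite eqEsubset UI // subsetI !SU.
rewrite disjoint_subset; apply/subsetP=> f /= fi; rewrite inE; apply/negP=> fj.
have [_ subi _ _] := treeE i; have [_ subj _ _] := treeE j.
have [u [v [fuv _ /andP[_ /negP nS] uU vU]]] := subi _ fi.
have [u' [v' [fuv' _ _ uU' vU']]] := subj _ fj.
have fU a : a \in f -> a \in U j.
  by rewrite fuv' !inE => /orP[]/eqP->.
apply: nS; apply/andP; split; apply: (subsetP (UI _ _ ij)); rewrite inE ?uU ?vU.
  by apply: fU; rewrite fuv !inE eqxx.
by apply: fU; rewrite fuv !inE eqxx orbT.
Qed.

(** * Fans in the hypercube *)

Section Cube.
Variable m : nat.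
Local Notation cube := {ffun 'I_m -> bool}.
Implicit Types (o a u v : cube) (i j l : 'I_m).

Definition flip i u : cube := [ffun l => (l == i) (+) u l].

Definition cube_adj : rel cube := fun u v => [exists i, v == flip i u].

Lemma flipK i : involutive (flip i).
Proof. by move=> u; apply/ffunP=> l; rewrite !ffunE addKb. Qed.

Lemma flip_injl u : injective (flip^~ u).
Proof.
move=> i j /ffunP/(_ i); rewrite !ffunE eqxx => /addIb/esym/eqP //.
Qed.

Lemma cube_adj_sym : symmetric cube_adj.
Proof.
by move=> u v; apply/existsP/existsP=> -[i /eqP->]; exists i; rewrite flipK.
Qed.

Lemma cube_adj_irr : irreflexive cube_adj.
Proof.
move=> u; apply/existsP=> -[i /eqP/ffunP/(_ i)].
by rewrite ffunE eqxx; case: (u i).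
Qed.

Lemma eq_or_cube_adj u v i :
  (forall l, l != i -> u l = v l) -> u = v \/ cube_adj u v.
Proof.
move=> uv; have [eqi|neqi] := eqVneq (u i) (v i).
  by left; apply/ffunP=> l; have [->|/uv] := eqVneq l i.
right; apply/existsP; exists i; apply/eqP/ffunP=> l; rewrite ffunE.
by have [->|/uv->//] := eqVneq l i; move: neqi; case: (u i) (v i) => -[].
Qed.

(** The residue of [l - i] modulo [m]: the number of steps forward from [i] to [l] in the cyclic
    order of coordinates. *)
Definition cdist i l : nat := if i <= l then l - i else l + m - i.

Lemma cdist_lt i l : cdist i l < m.
Proof. by have := ltn_ord l; have := ltn_ord i; rewrite /cdist; case: ifP; lia. Qed.

Lemma cdist_inj i : injective (cdist i).
Proof.
move=> k l kl; apply/val_inj => /=; move: kl (ltn_ord i) (ltn_ord k) (ltn_ord l).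
by rewrite /cdist; do 2 case: ifP; lia.
Qed.

(** The hypotheses put [l] both on the open arc from [j] to [i] and on the open arc from [i] to [j],
    which are disjoint. *)
Lemma cdist_covers i j l :
  i != j -> cdist i j < cdist i l -> cdist j i < cdist j l -> False.
Proof.
rewrite -val_eqE /= => ij; move: (ltn_ord i) (ltn_ord j) (ltn_ord l).
by rewrite /cdist; do ! case: ifP; lia.
Qed.

(* Starting from the neighbour of o in direction i, the coordinates of o are
   changed into those of a in the cyclic order i+1, i+2, ...; the walk ends
   at a or at its neighbour in direction i. *)
Definition walk o a i (r : nat) : cube :=
  [ffun l => if l == i then ~~ o l else if cdist i l <= r then a l else o l].

Definition fan_set o a i : {set cube} := a |: [set walk o a i r | r : 'I_m].

Lemma walk0 o a i : walk o a i 0 = flip i o.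
Proof.
apply/ffunP=> l; rewrite !ffunE; have [//|li] := eqVneq l i.
rewrite leqn0; have -> // : (cdist i l == 0) = false.
apply/eqP=> d0; have : cdist i l = cdist i i by rewrite d0 /cdist leqnn subnn.
by move/cdist_inj/eqP; rewrite (negPf li).
Qed.

(** Only the coordinate at cyclic distance [r.+1] from [i] can change. The walk stalls if [o] and
    [a] agree there, or if there is no such coordinate. *)
Lemma walk_step o a i r :
  walk o a i r = walk o a i r.+1 \/ cube_adj (walk o a i r) (walk o a i r.+1).
Proof.
have [/existsP[k /eqP kr]|none] := boolP [exists k, cdist i k == r.+1].
  apply: (@eq_or_cube_adj _ _ k) => l lk; rewrite !ffunE.
  case: eqP => // _; have -> // : (cdist i l <= r.+1) = (cdist i l <= r).
  rewrite leq_eqVlt -kr; case: eqP => [/cdist_inj lk'|_]; last by rewrite kr.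
  by rewrite lk' eqxx in lk.
left; apply/ffunP=> l; rewrite !ffunE; case: eqP => // _.
have -> // : (cdist i l <= r.+1) = (cdist i l <= r).
rewrite leq_eqVlt; case: eqP => // lr.
by case/negP: none; apply/existsP; exists l; rewrite lr.
Qed.

Lemma walk_last o a i :
  walk o a i m.-1 = a \/ cube_adj (walk o a i m.-1) a.
Proof.
apply: (@eq_or_cube_adj _ _ i) => l li; rewrite ffunE (negPf li).
by have := cdist_lt i l; case: ifP => //; lia.
Qed.

Lemma walk_fan_set o a i r : r < m -> walk o a i r \in fan_set o a i.
Proof.
by move=> rm; apply/setU1P; right; apply/imsetP; exists (Ordinal rm).
Qed.

Lemma source_fan_set o a i : a \in fan_set o a i.
Proof. exact: setU11. Qed.

Lemma target_fan_set o a i : flip i o \in fan_set o a i.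
Proof. by rewrite -(walk0 o a); apply: walk_fan_set; apply: leq_ltn_trans (ltn_ord i). Qed.

Lemma fan_set_connect o a i u :
  u \in fan_set o a i ->
  connect (induced_rel cube_adj (fan_set o a i)) u (flip i o).
Proof.
have m0 : 0 < m by apply: leq_ltn_trans (ltn_ord i).
have esym : symmetric (induced_rel cube_adj (fan_set o a i)).
  by move=> b c; rewrite /induced_rel cube_adj_sym andbCA.
have toward r : r < m ->
    connect (induced_rel cube_adj (fan_set o a i)) (walk o a i r) (flip i o).
  elim: r => [|r IH] rm; first by rewrite walk0 connect0.
  rewrite (sym_connect_sym esym); case: (walk_step o a i r) => [<-|adj].
    by rewrite (sym_connect_sym esym) IH // ltnW.
  rewrite (sym_connect_sym esym).
  apply: connect_trans (IH (ltnW rm)); apply: connect1.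
  by rewrite esym /induced_rel !walk_fan_set // ltnW.
case/setU1P=> [->|/imsetP[r _ ->]]; last exact: toward.
have lt : m.-1 < m by rewrite prednK.
case: (walk_last o a i) => [wa|adj]; first by rewrite -[X in connect _ X _]wa toward.
apply: connect_trans (toward _ lt); apply: connect1.
by rewrite esym /induced_rel walk_fan_set // source_fan_set.
Qed.

(** At a common vertex of two walks, coordinate [i] is flipped, so the walk from [j] has already
    passed [i] and [a] differs from [o] there; likewise with [i] and [j] exchanged. The two
    stretches then cover all coordinates, so the vertex is [a]. *)
Lemma fan_setI o a i j :
  i != j -> fan_set o a i :&: fan_set o a j \subset [set a].
Proof.
move=> ij; apply/subsetP=> u; rewrite !inE => /andP[/predU1P[->//|]].
move=> /imsetP[r _ ui] /predU1P[->//|] /imsetP[s _ uj].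
apply/eqP/ffunP=> l.
have uiE k : u k = if k == i then ~~ o k else if cdist i k <= r then a k else o k.
  by rewrite ui ffunE.
have ujE k : u k = if k == j then ~~ o k else if cdist j k <= s then a k else o k.
  by rewrite uj ffunE.
have [dji ai] : cdist j i <= s /\ a i = ~~ o i.
  by have := uiE i; rewrite ujE eqxx (negPf ij); case: ifP => // _; case: (o i).
have [dij aj] : cdist i j <= r /\ a j = ~~ o j.
  have := ujE j; rewrite uiE eqxx eq_sym (negPf ij).
  by case: ifP => // _; case: (o j).
have [->|li] := eqVneq l i; first by rewrite uiE eqxx.
have [->|lj] := eqVneq l j; first by rewrite ujE eqxx.
have := uiE l; rewrite (negPf li); case: leqP => // il _.
have := ujE l; rewrite (negPf lj); case: leqP => // jl _.
by case: (@cdist_covers i j l ij); lia.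
Qed.

(** Any [u] is the source of a fan branch centred at [flip i v], and this branch ends at [v]. *)
Lemma cube_connect u v : 0 < m -> connect cube_adj u v.
Proof.
move=> m0; pose i := Ordinal m0.
have := fan_set_connect (source_fan_set (flip i v) u i); rewrite flipK.
apply: connect_sub => b c /and3P[_ _ bc]; exact: connect1.
Qed.

(** * Choice of the hub clusters *)

Definition parity u : bool := \big[addb/false]_l u l.

Lemma parity_flip i u : parity (flip i u) = ~~ parity u.
Proof.
rewrite /parity (eq_bigr (fun l => (l == i) (+) u l)); last by move=> l; rewrite ffunE.
rewrite big_split /= (bigD1 i) //= eqxx big1 ?addbF ?addTb //.
by move=> l /negPf.
Qed.

(* One of the two parity classes contains at most one forbidden vertex p;
   take o in the other class, at distance 3 from p. *)
Lemma exists_center (P : seq cube) :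
  3 <= m -> size P <= 3 -> exists o, forall i, flip i o \notin P.
Proof.
move=> m3 P3.
have [b cb] : exists b, count (fun p => parity p == b) P <= 1.
  have := count_predC (fun p => parity p == true) P.
  rewrite (@eq_count _ (predC _) (fun p => parity p == false)); last first.
    by move=> p /=; case: (parity p).
  by move=> c; case: (leqP (count (fun p => parity p == true) P) 1) => ?;
    [exists true | exists false; lia].
pose i0 := Ordinal (leq_trans (isT : 0 < 3) m3).
pose i1 := Ordinal (leq_trans (isT : 1 < 3) m3).
pose i2 := Ordinal (leq_trans (isT : 2 < 3) m3).
have [/hasP[p pP /eqP pb]|/hasPn none] := boolP (has (fun p => parity p == b) P).
  exists (flip i0 (flip i1 (flip i2 p))) => i; apply/negP=> qP.
  set q := flip i _ in qP.
  have qb : parity q == b by rewrite !parity_flip !negbK pb.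
  (* [q] arises from [p] by the flips [i0], [i1], [i2] and [i]; at least one of the first three is
     not undone by the last. *)
  have qp : q != p.
    apply/eqP=> /ffunP qp.
    have [k ki k2] : exists2 k, k != i & k \in [:: i0; i1; i2].
      have [->|] := eqVneq i i0; first by exists i1.
      by exists i0; rewrite ?inE ?eqxx // eq_sym.
    have := qp k; rewrite !ffunE (negPf ki); move: k2; rewrite !inE.
    by case/or3P=> /eqP-> /=; case: (p _).
  have : 2 <= count (fun p => parity p == b) P.
    rewrite -size_filter; apply: (@uniq_leq_size _ [:: p; q]).
      by rewrite /= inE eq_sym qp.
    move=> t; rewrite !inE mem_filter.
    by case/orP=> /eqP->; rewrite ?pP ?qP ?pb ?qb ?eqxx.
  by rewrite leqNgt ltnS cb.
pose z : cube := [ffun=> false].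
have [o ob] : exists o, parity o = ~~ b.
  have [?|zb] := eqVneq (parity z) (~~ b); first by exists z.
  by exists (flip i0 z); rewrite parity_flip; move: zb; case: (parity z) b {cb none} => -[].
exists o => i; apply/negP=> /none; rewrite parity_flip ob negbK eqxx //.
Qed.

Lemma exists_avoiding (P : seq cube) :
  m + size P <= 2 ^ m -> exists2 c : 'I_m -> cube, injective c & forall i, c i \notin P.
Proof.
move=> le; pose A := [set u | u \notin P].
have mA : m <= #|A|.
  have := cardsC A; rewrite card_ffun card_bool card_ord.
  have : #|~: A| <= size P.
    apply: leq_trans (card_size P); apply/subset_leq_card/subsetP=> u.
    by rewrite !inE negbK.
  by lia.
exists (fun i => enum_val (widen_ord mA i)) => [i j /enum_val_inj/(congr1 val) ij|i].
  exact: val_inj.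
by have := enum_valP (widen_ord mA i); rewrite inE.
Qed.

(** [A] stands for the terminals that need a fan and [P] for the forbidden indices. If [A] is
    nonempty, [P] has at most three entries and a centre exists; otherwise any injective choice
    outside [P] serves, with an arbitrary centre. *)
Lemma exists_targets (A P : seq cube) :
  3 <= m -> size A + size P <= 4 ->
  exists co : ('I_m -> cube) * cube,
    [/\ injective co.1, forall i, co.1 i \notin P
      & forall a, a \in A -> co.1 =1 flip^~ co.2].
Proof.
move=> m3 sAP; case: A sAP => [|a A] /= sAP.
  have [|c cinj cP] := @exists_avoiding P.
    apply: (@leq_trans (m + 4)); first by lia.
    (* The bound [m + 4 <= 2 ^ m] starts at [m = 3], where it reads 7 <= 8. *)
    elim: {sAP} m m3 => // k IH; rewrite leq_eqVlt => /predU1P[<- //|/IH].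
    by rewrite expnS; lia.
  by exists (c, [ffun=> false]).
have [|o oP] := @exists_center P m3; first by lia.
by exists (flip^~ o, o); split=> //; apply: flip_injl.
Qed.

End Cube.

(** * The dual cube in cluster coordinates and the vertex sets of the trees *)

Section Model.
Variable m : nat.
Local Notation cube := {ffun 'I_m -> bool}.

(* (class, position inside the cluster, index of the cluster): with these
   coordinates the edge leaving a cluster swaps position and index. *)
Definition dualcube : finType := (bool * cube * cube)%type.
Implicit Types s t : dualcube.

Definition cls t : bool := t.1.1.
Definition pos t : cube := t.1.2.
Definition idx t : cube := t.2.

Definition dualcube_adj : rel dualcube := fun s t =>
  [|| [&& cls s == cls t, idx s == idx t & cube_adj (pos s) (pos t)]
    | t == (~~ cls s, idx s, pos s)].

Lemma dualcube_tree_sets (ts : seq dualcube) :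
  3 <= m -> size ts <= 4 -> uniq [seq (cls t, idx t) | t <- ts] ->
  exists (U : 'I_m -> {set dualcube}) (h : 'I_m -> dualcube),
  [/\ forall i, [set t in ts] \subset U i,
      forall i, h i \in U i,
      forall i, {in U i, forall t, connect
        (induced_rel (leaving dualcube_adj [set t in ts]) (U i)) t (h i)}
    & forall i j, i != j -> U i :&: U j \subset [set t in ts]].
Proof.
move=> m3 ts4 tsuniq.
have m0 : 0 < m by lia.
(* Each terminal counts once: as a source of fans towards class [b], or as the owner of a forbidden
   cluster of class [b]. *)
have szP b : size [seq pos t | t <- ts & cls t == ~~ b] +
    size [seq idx t | t <- ts & cls t == b] <= 4.
  rewrite !size_map !size_filter; apply: leq_trans ts4.
  rewrite -(count_predC (fun t => cls t == b) ts) addnC leq_add2l.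
  by apply/eq_leq/eq_count => t /=; case: (cls t) b => -[].
have keyinj s t : s \in ts -> t \in ts -> cls s = cls t -> idx s = idx t -> s = t.
  move=> sts tts cst ist; apply: (uniq_map_inj_in tsuniq) => //=.
  by rewrite cst ist.
have /fin_all_exists[co coP] (b : bool) := @exists_targets m
  [seq pos t | t <- ts & cls t == ~~ b] [seq idx t | t <- ts & cls t == b] m3 (szP b).
pose d b := (co b).1; pose o b := (co b).2.
have dinj b : injective (d b) by case: (coP b).
have dts t : t \in ts -> forall i, (idx t == d (cls t) i) = false.
  move=> tts i; apply/eqP=> ti; case: (coP (cls t)) => _ /(_ i) ni _; case/negP: ni.
  by rewrite -/(d (cls t)) -ti; apply: map_f; rewrite mem_filter eqxx.
have dfan i t : t \in ts -> d (~~ cls t) i = flip i (o (~~ cls t)).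
  move=> tts; case: (coP (~~ cls t)) => _ _ /(_ (pos t)); apply.
  by apply: map_f; rewrite mem_filter negbK eqxx.
pose fan i (s t : dualcube) := [&& cls s == cls t, idx s == idx t
  & pos t \in fan_set (o (~~ cls s)) (pos s) i].
(* The two hub clusters together with the [i]-th fan branch of every terminal. *)
pose U i : {set dualcube} := [set t | (idx t == d (cls t) i) || has (fan i ^~ t) ts].
(* The class 0 end of the edge joining the two hubs. *)
pose h i : dualcube := (false, d true i, d false i).
have fullU i b u : (b, u, d b i) \in U i by rewrite inE /= eqxx.
have fanU i s t : s \in ts -> fan i s t -> t \in U i.
  by move=> sts st; rewrite inE; apply/orP; right; apply/hasP; exists s.
have adj_lift c k u v : cube_adj u v -> dualcube_adj (c, u, k) (c, v, k).
  by move=> uv; rewrite /dualcube_adj /= !eqxx uv.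
exists U, h; split.
- move=> i; apply/subsetP=> t; rewrite inE => tts; apply: (fanU i t) => //.
  by rewrite /fan !eqxx source_fan_set.
- by move=> i; apply: fullU.
- move=> i.
  set R := induced_rel _ _.
  have full b u : connect R (b, u, d b i) (h i).
    (* Hubs contain no terminal, so every edge with an end in a hub survives in [leaving]. *)
    have notin v c : (c, v, d c i) \in ts = false.
      by apply/negP=> /dts/(_ i); rewrite /= eqxx.
    have inside c v v' : connect R (c, v, d c i) (c, v', d c i).
      apply: (@homo_connect _ _ (@cube_adj m) R (fun v => (c, v, d c i))).
        move=> a a' aa'; rewrite /R /induced_rel !fullU /leaving adj_lift //=.
        by rewrite !inE notin.
      exact: cube_connect.
    (* Position [d (~~ b) i] is where the hub of class [b] meets the edge to the other hub; for
       class 0 this is already [h i]. *)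
    apply: connect_trans (inside b u (d (~~ b) i)) _.
    case: b => //=.
    apply: connect1; rewrite /R /induced_rel !fullU /leaving !inE notin andbT.
    by rewrite /dualcube_adj /= eqxx.
  move=> t tU; case: (t) (tU) => [[b u] k]; rewrite inE => /orP[/eqP/=->|]; first exact: full.
  case/hasP=> -[[c a] k'] sts; rewrite /fan /cls /idx /pos /=.
  case/and3P=> /eqP cb /eqP kk; rewrite {}cb {}kk in sts * => ufan.
  set F := fan_set _ _ _ in ufan.
  have FU v : v \in F -> (b, v, k) \in U i.
    by move=> vF; apply: fanU sts _; apply/and3P; split; rewrite ?eqxx.
  (* First along the fan branch to its target, then across to the hub of the other class, which is
     entered at position [k]. *)
  apply: (@connect_trans _ _ (b, d (~~ b) i, k)).
    have := fan_set_connect ufan; rewrite -(dfan i _ sts).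
    apply: (@homo_connect _ _ _ R (fun v => (b, v, k))) => v v' /and3P[vF v'F vv'].
    rewrite /R /induced_rel !FU //= /leaving adj_lift //=.
    (* A cluster holds at most one terminal, so no edge of a branch has both ends in the terminal
       set. *)
    apply/negP; rewrite !inE => /andP[/keyinj vts /vts/(_ erefl erefl)[eqv]].
    by rewrite eqv cube_adj_irr in vv'.
  apply: connect_trans (full (~~ b) k); apply: connect1.
  rewrite /R /induced_rel fullU FU; last by rewrite (dfan i _ sts) target_fan_set.
  rewrite /leaving /dualcube_adj /= eqxx orbT /= negb_and !inE; apply/orP; right.
  by apply/negP=> /dts/(_ i); rewrite /= eqxx.
(* Hubs of different trees are separated by injectivity of [d], hubs and branches by [dts]. Two
   branches in one cluster belong to the same terminal and meet only there by [fan_setI]. *)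
move=> i j ij; apply/subsetP=> t; rewrite !inE => /andP[/orP[/eqP ti|/hasP[s sts si]]].
  case/orP=> [|/hasP[s sts /and3P[/eqP cs /eqP is_ _]]].
    by rewrite ti => /eqP/dinj ij'; rewrite ij' eqxx in ij.
  by have := dts _ sts i; rewrite cs is_ ti eqxx.
have /and3P[/eqP cs /eqP ks si'] := si.
case/orP=> [tj|/hasP[s' sts' /and3P[/eqP cs' /eqP ks' sj]]].
  by have := dts _ sts j; rewrite cs ks tj.
have ss' : s' = s by apply: keyinj => //; congruence.
rewrite {}ss' {s' sts' cs' ks'} in sj.
have : pos t \in [set pos s] by apply: (subsetP (fan_setI (o (~~ cls s)) (pos s) ij)); rewrite inE si'.
move=> /set1P pts; suff -> : t = s by [].
by move: cs ks pts; rewrite /cls /idx /pos; case: (t) (s) => [[? ?] ?] [[? ?] ?] /= -> -> ->.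
Qed.
End Model.

(** * Cluster coordinates versus bit strings *)

Section Coordinates.
Variable n : nat.
Hypothesis n_gt0 : 0 < n.
Local Notation W := (dualcube (n - 1)).

(** The low half varies inside clusters of class 0 and the high half inside those of class 1, so
    [pos] and [idx] trade halves with the class. Both [insub] tests fail only at the last bit. *)
Definition to_vert (t : W) : vert n :=
  let a := if cls t then idx t else pos t in
  let b := if cls t then pos t else idx t in
  [tuple if insub (j : nat) is Some i then a i
         else if insub (j - (n - 1)) is Some i then b i else cls t
  | j < 2 * n - 1].

Definition of_vert (v : vert n) : W :=
  let a := [ffun i : 'I_(n - 1) => bit v i] in
  let b := [ffun i : 'I_(n - 1) => bit v (n - 1 + i)] in
  if lastbit v then (true, b, a) else (false, a, b).

Lemma tnth_bit (v : vert n) (j : 'I_(2 * n - 1)) : tnth v j = bit v j.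
Proof. exact: tnth_nth. Qed.

Lemma bit_to_vert_low t (i : 'I_(n - 1)) :
  bit (to_vert t) i = (if cls t then idx t else pos t) i.
Proof.
have lt : i < 2 * n - 1 by have := ltn_ord i; lia.
by rewrite -(tnth_bit _ (Ordinal lt)) tnth_mktuple /= valK.
Qed.

Lemma bit_to_vert_high t (i : 'I_(n - 1)) :
  bit (to_vert t) (n - 1 + i) = (if cls t then pos t else idx t) i.
Proof.
have lt : n - 1 + i < 2 * n - 1 by have := ltn_ord i; lia.
rewrite -(tnth_bit _ (Ordinal lt)) tnth_mktuple /= insubN; last by lia.
by rewrite addKn valK.
Qed.

Lemma lastbit_to_vert t : lastbit (to_vert t) = cls t.
Proof.
have lt : 2 * n - 2 < 2 * n - 1 by lia.
rewrite /lastbit -(tnth_bit _ (Ordinal lt)) tnth_mktuple /= insubN; last by lia.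
by rewrite insubN //; lia.
Qed.

Variant position_spec (j : nat) : Prop :=
  | LowPosition (i : 'I_(n - 1)) of j = i
  | HighPosition (i : 'I_(n - 1)) of j = n - 1 + i
  | LastPosition of j = 2 * n - 2.

Lemma positionP j : j < 2 * n - 1 -> position_spec j.
Proof.
move=> jn; case: (ltnP j (n - 1)) => [lt|ge]; first exact: (@LowPosition _ (Ordinal lt)).
have [lt|ge'] := ltnP (j - (n - 1)) (n - 1); last by apply: LastPosition; lia.
by apply: (@HighPosition _ (Ordinal lt)) => /=; lia.
Qed.

Lemma eq_bits (u v : vert n) :
  (forall i : 'I_(n - 1), bit u i = bit v i) ->
  (forall i : 'I_(n - 1), bit u (n - 1 + i) = bit v (n - 1 + i)) ->
  lastbit u = lastbit v -> u = v.
Proof.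
move=> low high last; apply: eq_from_tnth => j; rewrite !tnth_bit.
by case: (positionP (ltn_ord j)) => [i|i|] ->.
Qed.

Lemma to_vertK : cancel to_vert of_vert.
Proof.
move=> t; rewrite /of_vert lastbit_to_vert.
have -> : [ffun i : 'I_(n - 1) => bit (to_vert t) i]
    = if cls t then idx t else pos t.
  by apply/ffunP=> i; rewrite ffunE bit_to_vert_low.
have -> : [ffun i : 'I_(n - 1) => bit (to_vert t) (n - 1 + i)]
    = if cls t then pos t else idx t.
  by apply/ffunP=> i; rewrite ffunE bit_to_vert_high.
by case: t => [[[] p] k].
Qed.

Lemma of_vertK : cancel of_vert to_vert.
Proof.
move=> v; apply: eq_bits => [i|i|].
- by rewrite bit_to_vert_low /of_vert; case: (lastbit v); rewrite /cls /idx /pos /= ffunE.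
- by rewrite bit_to_vert_high /of_vert; case: (lastbit v); rewrite /cls /idx /pos /= ffunE.
- by rewrite lastbit_to_vert /of_vert; case: (lastbit v).
Qed.

Lemma dc_adj_to_vert s t : dualcube_adj s t -> dc_adj (to_vert s) (to_vert t).
Proof.
have adjI (u v : vert n) j0 (lt : j0 < 2 * n - 1) :
    (forall k, k < 2 * n - 1 -> (bit u k != bit v k) = (k == j0)) ->
    (if (j0 < n - 1)%N then ~~ lastbit u && ~~ lastbit v
      else if (j0 < 2 * n - 2)%N then lastbit u && lastbit v
      else true) -> dc_adj u v.
  move=> diff cond; apply/existsP; exists (Ordinal lt); rewrite cond andbT.
  by apply/forallP=> k; rewrite !tnth_bit diff ?ltn_ord // eqxx.
case/orP=> [|/eqP->].
  case/and3P=> /eqP cst /eqP ist /existsP[i /eqP pst].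
  have lti := ltn_ord i.
  (* The changed bit lies in the half that stores [pos]. *)
  have lt : (if cls s then n - 1 + i else i) < 2 * n - 1 by case: ifP; lia.
  apply: (adjI _ _ _ lt) => [k kn|].
    case: (positionP kn) => [l|l|] ->; try have ltl := ltn_ord l.
    - rewrite !bit_to_vert_low -cst -ist pst; case: (cls s).
        by rewrite eqxx; lia.
      by rewrite ffunE -val_eqE /=; case: (_ == _ :> nat); case: (pos s l).
    - rewrite !bit_to_vert_high -cst -ist pst; case: (cls s).
        by rewrite ffunE eqn_add2l -val_eqE /=; case: (_ == _ :> nat); case: (pos s l).
      by rewrite eqxx; lia.
    - rewrite -/(lastbit _) -/(lastbit (to_vert t)) !lastbit_to_vert -cst eqxx.
      by case: ifP; lia.
  rewrite !lastbit_to_vert -cst; case: (cls s); last by rewrite lti.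
  by rewrite ltnNge leq_addr /= [X in if X then _ else _](_ : _ = true) //; lia.
(* For a cross edge, swapping [pos] with [idx] and changing the class leaves both halves as they
   are; only the last bit changes. *)
have lt : 2 * n - 2 < 2 * n - 1 by lia.
apply: (adjI _ _ _ lt) => [k kn|]; last first.
  by rewrite ltnn; case: ifP => //; lia.
case: (positionP kn) => [l|l|] ->; try have ltl := ltn_ord l.
- by rewrite !bit_to_vert_low; case: (s) => [[[] p] q]; rewrite eqxx; lia.
- by rewrite !bit_to_vert_high; case: (s) => [[[] p] q]; rewrite eqxx; lia.
- rewrite -/(lastbit _) -/(lastbit (to_vert _)) !lastbit_to_vert eqxx.
  by case: (s) => [[[] p] q].
Qed.

Lemma eq_cluster (u v : vert n) :
  cls (of_vert u) = cls (of_vert v) -> idx (of_vert u) = idx (of_vert v) ->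
  cluster u = cluster v.
Proof.
rewrite /of_vert /cluster.
case: (lastbit u) (lastbit v) => -[] // _ /ffunP /= uv; congr (_, _).
  apply: (@eq_from_nth _ false) => [|j]; rewrite !size_takel ?size_tuple //; try lia.
  move=> jn; rewrite !nth_take //.
  by have := uv (Ordinal jn); rewrite !ffunE.
apply: (@eq_from_nth _ false) => [|j]; rewrite !size_drop !size_takel ?size_tuple //; try lia.
move=> jn; rewrite !nth_drop !nth_take; try lia.
have jn' : j < n - 1 by lia.
by have := uv (Ordinal jn'); rewrite !ffunE.
Qed.

End Coordinates.

(** * Transport of the vertex sets to the dual cube *)

Lemma dc_adj_irr n : irreflexive (@dc_adj n).
Proof.
move=> u; apply/existsP=> -[j /andP[/forallP/(_ j)]].
by rewrite !eqxx.
Qed.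

Theorem mainTheorem5 (n : nat) (hn : (4 <= n)%N) (x y z w : vert n)
  (hdist : uniq [:: x; y; z; w])
  (hclus : uniq [:: cluster x; cluster y; cluster z; cluster w]) :
  exists T : 'I_(n - 1) -> {set vert n} * {set {set vert n}},
    internally_disjoint_Strees (@dc_adj n) [set x; y; z; w] T.
Proof.
have n0 : 0 < n by lia.
pose vs := [:: x; y; z; w]; pose ts := map (@of_vert n) vs.
have uts : uniq [seq (cls t, idx t) | t <- ts].
  rewrite -map_comp map_inj_in_uniq; first exact: hdist.
  (* Terminals with equal class and index share a cluster, so they coincide by [hclus]. *)
  move=> u v uvs vvs [cuv iuv]; apply: (@uniq_map_inj_in _ _ (@cluster n) vs) => //.
  exact: eq_cluster.
have [||U [h [SU hU conn UI]]] := @dualcube_tree_sets (n - 1) ts _ _ uts; [lia|by []|].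
have finj := can_inj (to_vertK n0).
have Sf : [set x; y; z; w] = @to_vert n @: [set t in ts].
  apply/setP=> v; rewrite -{2}(of_vertK n0 v) mem_imset // inE.
  by rewrite mem_map ?inE -?orbA //; apply: can_inj (of_vertK n0).
apply: (@internally_disjoint_Strees_of_sets _ _ _ _
  (fun i => @to_vert n @: U i) (fun i => to_vert (h i))).
- exact: dc_adj_irr.
- by move=> i; rewrite Sf imsetS.
- by move=> i; rewrite imset_f.
- move=> i _ /imsetP[t tU ->]; apply: homo_connect (conn i t tU) => a b.
  case/and3P=> aU bU /andP[ab nS]; rewrite /induced_rel /leaving !imset_f //=.
  by rewrite Sf !mem_imset // nS dc_adj_to_vert.
- by move=> i j /UI UIS; rewrite Sf -imsetI ?imsetS // => ? ? _ _; apply: finj.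
Qed.
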